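(* Let $E$ be a Salem field. Then there exists a Salem polynomial $S$ such that $E\simeq\mathbf{Q}[x]/(S)$.
   Context: A Salem field is a number field of degree $\geq 4$ having exactly two real embeddings, all other embeddings being complex, and having a $\mathbf{Q}$-linear involution (field automorphism whose square is the identity) with totally real fixed field. A Salem polynomial is a monic irreducible polynomial $S\in\mathbf{Z}[x]$ of degree $\geq 4$ such that $S(x)=x^{\deg(S)}S(x^{-1})$ and such that $S$ has exactly two roots not on the unit circle, both positive real numbers. *)

(* Defs.v *)
From HB Require Import structures.
From mathcomp Require Import all_boot all_order all_algebra all_field.
From mathcomp Require Import reals complex.

Set Implicit Arguments.
Unset Strict Implicit.
Unset Printing Implicit Defensive.

Import Order.TTheory GRing.Theory Num.Theory.
Local Open Scope ring_scope.
Local Open Scope complex_scope.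

(* A number field is a [fieldExtType rat]; the complex numbers are [R[i]] for
   [R : realType]. *)

Definition real_embedding (R : realType) (K : fieldExtType rat)
    (f : {rmorphism K -> R[i]}) : Prop :=
  forall x : K, f x \is Num.real.

Definition totally_real (R : realType) (K : fieldExtType rat) : Prop :=
  forall f : {rmorphism K -> R[i]}, real_embedding f.

Definition exactly_two_real_embeddings (R : realType) (K : fieldExtType rat) :
    Prop :=
  exists f1 f2 : {rmorphism K -> R[i]},
    [/\ real_embedding f1, real_embedding f2, ~ (f1 =1 f2)
      & forall g : {rmorphism K -> R[i]},
          real_embedding g -> g =1 f1 \/ g =1 f2].

Definition salem_field (R : realType) (E : fieldExtType rat) : Prop :=
  [/\ (4 <= \dim {:E})%N, exactly_two_real_embeddings R E
    & exists sigma : 'AEnd(E),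
        involutive sigma /\ totally_real R (subvs_of (fixedSpace sigma))].

(* Irreducibility in the ring [{poly int}]; the library's [irreducible_poly]
   over a non-field is about pseudo-divisibility. *)
Definition irreducible_in (A : unitRingType) (p : A) : Prop :=
  p \isn't a GRing.unit /\
  forall a b : A, p = a * b -> a \is a GRing.unit \/ b \is a GRing.unit.

(* x^(deg p) * p(x^-1), expanded over the coefficients of p *)
Definition reciprocal_poly (A : nzRingType) (p : {poly A}) : {poly A} :=
  \sum_(i < size p) p`_i *: 'X^((size p).-1 - i).

Definition salem_roots (R : realType) (S : {poly int}) : Prop :=
  let SC : {poly R[i]} := map_poly intr S in
  exists a b : R,
    [/\ 0 < a, 0 < b, a != b,
        [/\ root SC a%:C, root SC b%:C, `|a%:C| != 1 & `|b%:C| != 1]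
      & forall z : R[i], root SC z -> `|z| != 1 -> z = a%:C \/ z = b%:C].

Definition salem_poly (R : realType) (S : {poly int}) : Prop :=
  [/\ S \is monic, irreducible_in S, (4 < size S)%N,
      S = reciprocal_poly S & salem_roots R S].

(* Main.v *)
Require Import Defs.
From HB Require Import structures.
From mathcomp Require Import all_boot all_order all_algebra all_field.
From mathcomp Require Import reals complex.
From mathcomp Require Import zify ring lra.

Set Implicit Arguments.
Unset Strict Implicit.
Unset Printing Implicit Defensive.

Import Order.TTheory GRing.Theory Num.Theory.
Local Open Scope ring_scope.

(* Let sigma be the involution of E and n the degree of E. It exchanges the two
   real embeddings f1, f2, and every other embedding g satisfies
   conj (g z) = g (sigma z), because the fixed field is totally real and E is
   quadratic over it. Hence if v is a unit with |f1 v| <> |f2 v|, then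
   u = (sigma v / v)^2 satisfies u * sigma u = 1, its images under f1 and f2 are
   positive and different from 1, and all its other conjugates lie on the unit
   circle; as f1 u is not the image of u under any other embedding, E = Q(u),
   and the minimal polynomial of u is the required Salem polynomial.

   The unit v comes from the pigeonhole principle in one variable, without
   Dirichlet's unit theorem. Let E = Q(t) with t integral. For every m there is
   a nonzero element of Z[t] with coefficients at most m and image under f1 of
   size O(m^(1-n)). Its norm is bounded independently of m by some B, whereas
   |f1| / |f2| tends to 0 as m grows; two such elements that are congruent
   modulo B! and have distinct ratios |f1| / |f2| have a quotient which is a
   unit. *)

(** * Integral primitive elements *)

Lemma map_rmorph_intr (A B : nzRingType) (f : {rmorphism A -> B})
    (p : {poly int}) :
  map_poly f (map_poly intr p) = map_poly intr p.
Proof. by rewrite -map_poly_comp; apply: eq_map_poly => a; exact: rmorph_int. Qed.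

Section PrimitiveElement.

Variable E : fieldExtType rat.

Implicit Types (u x : E) (p : {poly int}) (q : {poly rat}).

Lemma intr_fext_eq0 (d : int) : ((d%:~R : E) == 0) = (d == 0).
Proof. by rewrite -(rmorph_int (in_alg E)) fmorph_eq0 intr_eq0. Qed.

Lemma map_in_alg_intr p :
  map_poly (in_alg E) (map_poly intr p : {poly rat}) = map_poly intr p.
Proof. exact: map_rmorph_intr. Qed.

(** Gauss's lemma: the minimal polynomial over Q divides a monic integral polynomial, so it is
    proportional to an integral factor whose leading coefficient is 1 or -1. *)
Lemma integral_minPoly u :
    integralOver (intr : int -> E) u ->
  exists2 p, p \is monic & map_poly intr p = minPoly 1%AS u.
Proof.
case=> q mon_q qu.
have /polyOver1P[m Dm] := minPolyOver 1%AS u.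
have mon_m : m \is monic by rewrite -(map_monic (in_alg E)) -Dm monic_minPoly.
have: m %| map_poly intr q.
  rewrite -(dvdp_map (in_alg E)) map_in_alg_intr -Dm.
  by apply: minPoly_dvdp qu; rewrite -map_in_alg_intr alg_polyOver.
case/dvdpP_rat_int=> p [a nz_a Dma] [r Dq].
have lead1 : lead_coef p * lead_coef r = 1 by rewrite -lead_coefM -Dq (monicP mon_q).
have a1 : a * (lead_coef p)%:~R = 1.
  move: (monicP mon_m); rewrite Dma lead_coefZ lead_coef_map_inj //.
  exact: intr_inj.
have sq1 : lead_coef p * lead_coef p = 1.
  by move: lead1; rewrite mulrC => /intUnitRing.unitzPl/orP[] /eqP->.
exists (lead_coef p *: p).
  by rewrite monicE lead_coefZ sq1.
rewrite Dm Dma -map_in_alg_intr map_polyZ; congr (map_poly _ (_ *: _)).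
by rewrite -[LHS]mul1r -a1 -mulrA -intrM sq1 mulr1.
Qed.

(** The multiplier is a common denominator [a] of the minimal polynomial of [x]. As that polynomial
    is monic, [a] is also its leading coefficient once denominators are cleared. *)
Lemma integral_multiple x :
  exists2 d : int, d != 0 & integralOver (intr : int -> E) (d%:~R * x).
Proof.
have /polyOver1P[m Dm] := minPolyOver 1%AS x.
have mon_m : m \is monic by rewrite -(map_monic (in_alg E)) -Dm monic_minPoly.
have [q [a nz_a Dma]] := rat_poly_scale m.
have a0 : (a%:~R : rat) != 0 by rewrite intr_eq0.
have szm : size m = size q.
  by rewrite Dma size_scale ?invr_eq0 // size_map_inj_poly //; apply: intr_inj.
have [n Dn] : exists n, size q = n.+1.
  by exists (size q).-1; rewrite -szm prednK // size_poly_gt0 monic_neq0.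
have lq : lead_coef q = a.
  apply: (@intr_inj rat); move: (monicP mon_m).
  rewrite Dma lead_coefZ lead_coef_map_inj //; last exact: intr_inj.
  by move/(canRL (mulKf _)); rewrite invr_eq0 invrK mulr1; apply.
exists a => //.
(* The monic integral polynomial a^(deg q - 1) q(X / a), with a = lead_coef q. *)
exists ('X^n + \poly_(i < n) (q`_i * a ^+ (n.-1 - i))).
  rewrite monicE lead_coefDl ?lead_coefXn // size_polyXn ltnS; exact: size_poly.
have qx : (map_poly intr q).[x] = 0.
  have : root (map_poly (in_alg E) (a%:~R^-1 *: map_poly intr q)) x.
    by rewrite -Dma -Dm root_minPoly.
  rewrite map_polyZ rootZ ?map_in_alg_intr; first by move/rootP.
  by rewrite fmorph_eq0 invr_eq0.
move: qx; rewrite (@horner_coef_wide _ n.+1); last by rewrite -Dn size_poly.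
rewrite big_ord_recr /= coef_map /= -[n in q`_n]/(n.+1.-1) -Dn.
rewrite -[q`__]/(lead_coef q) lq => qx.
apply/rootP; rewrite rmorphD /= map_polyXn hornerD hornerXn.
rewrite (@horner_coef_wide _ n); last exact: leq_trans (size_poly _ _) (size_poly _ _).
under eq_bigr => i _ do rewrite coef_map coef_poly ltn_ord /=.
(* Degree 0, where [n.-1] truncates, is impossible: the nonzero constant [a] would vanish at [x]. *)
case: n => [|n] in Dn qx *.
  move/eqP: qx; rewrite !big_ord0 add0r expr0 mulr1 intr_fext_eq0 => /eqP a00.
  by rewrite a00 eqxx in nz_a.
transitivity (a%:~R ^+ n * 0 : E); last by rewrite mulr0.
rewrite -[in RHS]qx mulrDr mulr_sumr addrC; congr (_ + _).
  apply: eq_bigr => i _; rewrite coef_map /= rmorphM rmorphXn /= exprMn.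
  rewrite -mulrA [RHS]mulrCA; congr (_ * _).
  by rewrite mulrA -exprD subnK // -ltnS.
by rewrite exprMn exprSr mulrA.
Qed.

(** Characteristic zero gives a generator, and a nonzero integer multiple of it generates the same
    field. *)
Lemma integral_primitive_element :
  exists2 u, integralOver (intr : int -> E) u & <<1; u>>%VS = fullv.
Proof.
have sepE : separable 1 {:E}.
  apply/separableP => y _; apply: pcharf0_separable => p.
  by rewrite (fmorph_pchar (in_alg E)) pchar_num.
have defE := eq_adjoin_separable_generator sepE (sub1v _).
set x := separable_generator _ _ in defE.
have [d nz_d int_dx] := integral_multiple x.
exists (d%:~R * x) => //; apply/eqP; rewrite eqEsubv subvf /= defE.
apply/FadjoinP; split; first exact: sub1v.
have d0 : (d%:~R : E) != 0 by rewrite intr_fext_eq0.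
rewrite -[x in x \in _](mulKf d0) rpredM ?memv_adjoin // rpredV.
by rewrite (subvP (sub1v _)) // rpred_int.
Qed.

(** The minimal polynomial is kept over Z so that one [p] can be read over Q, in E and in C. *)
Definition primitive_with u p :=
  [/\ p \is monic, map_poly intr p = minPoly 1%AS u & <<1; u>>%VS = fullv].

Lemma primitive_size u p : primitive_with u p -> size p = (\dim {:E}).+1.
Proof.
case=> mon_p Dp Du; rewrite -Du dim_Fadjoin dimv1 muln1.
rewrite -(size_minPoly 1%AS) -Dp size_map_poly_id0 //.
by rewrite (monicP mon_p) oner_eq0.
Qed.

Lemma primitive_root u p : primitive_with u p -> (map_poly intr p).[u] = 0.
Proof. by case=> _ -> _; rewrite minPolyxx. Qed.

Lemma primitive_dvd u p q : primitive_with u p ->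
  ((map_poly (in_alg E) q).[u] == 0) = ((map_poly intr p : {poly rat}) %| q).
Proof.
move=> pu; have [mon_p Dp _] := pu; apply/idP/idP => [qu|].
  rewrite -(dvdp_map (in_alg E)) map_in_alg_intr Dp.
  by apply: minPoly_dvdp => //; apply: alg_polyOver.
case/dvdpP=> r ->; rewrite rmorphM hornerM /= map_in_alg_intr.
by rewrite (primitive_root pu) mulr0.
Qed.

Lemma primitive_horner u x : <<1; u>>%VS = fullv ->
  {q | x = (map_poly (in_alg E) q).[u]}.
Proof.
move=> Du; apply: sig_eqW.
have /Fadjoin_polyP[_ /polyOver1P[q ->] ->] : x \in <<1%AS; u>>%VS.
  by rewrite Du memvf.
by exists q.
Qed.

Lemma primitive_embedding (C : numFieldType) u p (r : C) :
    primitive_with u p -> root (map_poly intr p) r ->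
  exists g : {rmorphism E -> C}, g u = r.
Proof.
move=> pu pr; have [mon_p Dp Du] := pu.
pose cf x := sval (primitive_horner x Du).
have cfP x : (map_poly (in_alg E) (cf x)).[u] = x.
  exact: esym (svalP (primitive_horner x Du)).
(* The choice [cf] need not respect sums or products, but polynomials with equal value at [u] differ
   by a multiple of [p], which vanishes at [r]. *)
have ratr_eval q x : (map_poly (in_alg E) q).[u] = x ->
    (map_poly ratr q).[r] = (map_poly ratr (cf x)).[r].
  move=> Dx; have : (map_poly (in_alg E) (q - cf x)).[u] == 0.
    by rewrite rmorphB hornerD hornerN /= Dx cfP subrr.
  rewrite (primitive_dvd _ pu) => /dvdpP[s Ds].
  apply/eqP; rewrite -subr_eq0 -hornerN -hornerD -rmorphB Ds rmorphM hornerM /=.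
  by rewrite map_rmorph_intr (rootP pr) mulr0.
pose g x := (map_poly (ratr : rat -> C) (cf x)).[r].
have gB : zmod_morphism g.
  move=> x y; rewrite /g -hornerN -hornerD -rmorphB; apply/esym/ratr_eval.
  by rewrite rmorphB hornerD hornerN /= !cfP.
have gM : monoid_morphism g.
  split=> [|x y]; rewrite /g.
    by rewrite -(ratr_eval 1) ?rmorph1 ?hornerC.
  rewrite -hornerM -rmorphM; apply/esym/ratr_eval.
  by rewrite rmorphM hornerM /= !cfP.
pose gz := GRing.isZmodMorphism.Build _ _ g gB.
pose gm := GRing.isMonoidMorphism.Build _ _ g gM.
pose G : {rmorphism E -> C} := HB.pack g gz gm.
exists G; rewrite /= /g -(ratr_eval 'X) ?map_polyX ?hornerX //.
Qed.

Lemma primitive_ext (C : fieldType) u (f g : {rmorphism E -> C}) :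
  <<1; u>>%VS = fullv -> f u = g u -> f =1 g.
Proof.
move=> Du fgu x; have [q ->] := primitive_horner x Du.
rewrite -!horner_map /= fgu -!map_poly_comp; congr (_.[_]).
apply: eq_map_poly => a /=.
by rewrite alg_num_field !fmorph_rat.
Qed.

(** The map is evaluation at [u]. It is injective because reduced representatives with equal value
    differ by a multiple of [P] of smaller degree than [P]. *)
Lemma primitive_iso u p : primitive_with u p ->
  exists phi : {lrmorphism {poly %/ (map_poly intr p : {poly rat})} -> E},
    bijective phi.
Proof.
move=> pu; have [mon_p Dp Du] := pu; set P := map_poly intr p.
have mon_P : P \is monic by apply: monic_map.
have szP : (1 < size P)%N.
  rewrite size_map_inj_poly ?(primitive_size pu) //; last exact: intr_inj.
  by rewrite ltnS adim_gt0.
(* The quotient type reduces modulo [mk_monic P], which is [P] itself since [P] is monic and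
   nonconstant. *)
have DP : mk_monic P = P by rewrite /mk_monic szP mon_P.
pose ev (q : {poly rat}) : E := (map_poly (in_alg E) q).[u].
have ev_mod q : ev (Pdiv.CommonRing.rmodp q (mk_monic P)) = ev q.
  rewrite {2}(Pdiv.RingMonic.rdivp_eq mon_P q) /ev DP rmorphD rmorphM /=.
  rewrite hornerD hornerM {4}/P map_in_alg_intr (primitive_root pu).
  by rewrite mulr0 add0r.
pose phi (q : {poly %/ P}) : E := ev (val q).
have phiB : zmod_morphism phi.
  by move=> x y; rewrite /phi /ev /= rmorphB hornerD hornerN.
have phiM : monoid_morphism phi.
  split=> [|x y]; rewrite /phi.
    by rewrite /ev /= rmorph1 hornerC.
  by rewrite ev_mod /ev rmorphM hornerM.
have phiZ : scalable phi.
  by move=> a x; rewrite /phi /ev /= map_polyZ hornerZ /= mulr_algl.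
pose gz := GRing.isZmodMorphism.Build _ _ phi phiB.
pose gm := GRing.isMonoidMorphism.Build _ _ phi phiM.
pose gs := GRing.isScalable.Build _ _ _ _ phi phiZ.
pose G : {lrmorphism {poly %/ P} -> E} := HB.pack phi gz gm gs.
exists G; pose psi x : {poly %/ P} := in_qpoly P (sval (primitive_horner x Du)).
have psiK x : phi (psi x) = x.
  rewrite /phi /psi /= ev_mod.
  exact: esym (svalP (primitive_horner x Du)).
exists psi => // q; apply: val_inj; apply/eqP; rewrite -subr_eq0.
have szlt (y : {poly %/ P}) : (size (val y) < size P)%N.
  by rewrite -[P in X in (_ < X)%N]DP size_mk_monic.
have : P %| val (psi (G q)) - val q.
  by rewrite -(primitive_dvd _ pu) rmorphB hornerD hornerN -![_.[u]]/(phi _) psiK subrr.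
apply: contraLR => nz; apply/negP => /(dvdp_leq nz); apply/negP; rewrite -ltnNge.
by apply: leq_ltn_trans (size_polyD _ _) _; rewrite size_polyN gtn_max !szlt.
Qed.

End PrimitiveElement.

(** * Embeddings and norms *)

(** In characteristic zero [p] has as many distinct roots as its degree, and each root defines an
    embedding. *)
Lemma primitive_embeddings (E : fieldExtType rat) (C : numClosedFieldType)
    (u : E) (p : {poly int}) : primitive_with u p ->
  exists g : 'I_(\dim {:E}) -> {rmorphism E -> C},
    injective (fun i => g i u) /\
    forall z, root (map_poly intr p) z -> exists i, z = g i u.
Proof.
move=> pu; have [mon_p Dp Du] := pu.
have [rs Drs] := closed_field_poly_normal (map_poly intr p : {poly C}).
have mon_pC : (map_poly intr p : {poly C}) \is monic by apply: monic_map.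
rewrite (monicP mon_pC) scale1r in Drs.
have root_rs z : root (map_poly intr p) z = (z \in rs).
  by rewrite Drs root_prod_XsubC.
have sz_rs : size rs = \dim {:E}.
  apply: succn_inj; rewrite -(primitive_size pu) -(size_prod_XsubC _ id) -Drs.
  by rewrite size_map_inj_poly //; apply: intr_inj.
have uniq_rs : uniq rs.
  rewrite -separable_prod_XsubC -Drs -(map_rmorph_intr (ratr : {rmorphism rat -> C})).
  rewrite separable_map -(separable_map (in_alg E)) map_in_alg_intr Dp.
  apply: pcharf0_separable => l.
  by rewrite (fmorph_pchar (in_alg E)) pchar_num.
have [i | g Dg] := @fin_all_exists _ _
    (fun i (h : {rmorphism E -> C}) => h u = rs`_(i : 'I_(\dim {:E}))).
  by apply: (primitive_embedding pu); rewrite root_rs mem_nth ?sz_rs.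
exists g; split=> [i j | z].
  rewrite !Dg => /eqP; rewrite nth_uniq ?sz_rs // => /eqP; exact: val_inj.
rewrite root_rs => /(nthP 0)[i ltin <-]; rewrite sz_rs in ltin.
by exists (Ordinal ltin); rewrite Dg.
Qed.

Section NormForm.

Variables (p : {poly int}) (n : nat).
Hypotheses (mon_p : p \is monic) (sz_p : size p = n.+1).

(* Multiplication by q in the basis 1, X, ..., X^(n-1) of Z[X]/(p). *)
Definition mul_mx (q : {poly int}) : 'M[int]_n :=
  \matrix_(k, l) (Pdiv.CommonRing.rmodp (q * 'X^k) p)`_l.

(** A multiple of [p] vanishes at [z], so [q * 'X^k] and its remainder agree there: the powers of a
    root form an eigenvector. *)
Lemma mul_mxE (K : comNzRingType) (z : K) q :
    (map_poly intr p).[z] = 0 ->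
  map_mx intr (mul_mx q) *m (\col_l z ^+ l) =
    (map_poly intr q).[z] *: (\col_l z ^+ l).
Proof.
move=> pz; apply/matrixP=> k j; rewrite !mxE -[z ^+ k]hornerXn.
rewrite -(map_polyXn intr) -hornerM -rmorphM.
set m := q * 'X^k; rewrite [in RHS](Pdiv.RingMonic.rdivp_eq mon_p m).
rewrite rmorphD rmorphM hornerD hornerM /= pz mulr0 add0r.
rewrite (@horner_coef_wide _ n); last first.
  apply: leq_trans (size_poly _ _) _; rewrite -ltnS -sz_p.
  by apply: Pdiv.CommonRing.ltn_rmodpN0; apply: monic_neq0.
by apply: eq_bigr => l _; rewrite !mxE coef_map.
Qed.

Lemma det_mul_mx_eval (K : comNzRingType) (z : K) q : (0 < n)%N ->
    (map_poly intr p).[z] = 0 ->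
  exists s : {poly int},
    (map_poly intr s).[z] * (map_poly intr q).[z] = (\det (mul_mx q))%:~R.
Proof.
move=> n_gt0 pz; pose M := mul_mx q; pose i0 := Ordinal n_gt0.
(* The coefficients are the first row of the adjugate: applying the adjugate to the eigenvector
   equation and reading row 0, where [z ^+ 0 = 1], gives the claim. *)
exists (\poly_(l < n) oapp ((\adj M) i0) 0 (insub l)).
have := congr1 (mulmx (map_mx intr (\adj M))) (mul_mxE q pz).
rewrite mulmxA -map_mxM mul_adj_mx map_scalar_mx mul_scalar_mx -scalemxAr.
move/matrixP=> /(_ i0 0); rewrite !mxE expr0 mulr1 => ->; rewrite mulrC; congr (_ * _).
rewrite (@horner_coef_wide _ n); last exact: leq_trans (size_poly _ _) (size_poly _ _).
by apply: eq_bigr => l _; rewrite !mxE coef_map coef_poly ltn_ord /= valK /= mxE.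
Qed.

(** The Vandermonde matrix of the distinct roots diagonalizes [mul_mx q]; this identifies the
    determinant with the norm. *)
Lemma det_mul_mx_prod (K : idomainType) (r : 'I_n -> K) q :
    injective r -> (forall i, (map_poly intr p).[r i] = 0) ->
  (\det (mul_mx q))%:~R = \prod_i (map_poly intr q).[r i].
Proof.
move=> inj_r pr; pose V := Vandermonde n (\row_j r j).
have detV : \det V != 0.
  rewrite det_Vandermonde; apply/prodf_neq0 => i _; apply/prodf_neq0 => j ltij.
  rewrite !mxE subr_eq0; apply: contraTneq ltij => /inj_r->; by rewrite ltnn.
apply: (mulIf detV); rewrite -det_map_mx -det_mulmx.
suffices -> : map_mx intr (mul_mx q) *m V =
    V *m diag_mx (\row_j (map_poly intr q).[r j]).
  rewrite det_mulmx det_diag mulrC; congr (_ * _).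
  by apply: eq_bigr => i _; rewrite mxE.
apply/matrixP=> k j; move/matrixP: (mul_mxE q (pr j)) => /(_ k 0).
rewrite mul_mx_diag !mxE [RHS]mulrC => <-.
by apply: eq_bigr => l _; rewrite !mxE.
Qed.

End NormForm.

(** * Units from the pigeonhole principle *)

Lemma pigeonhole_interval (R : archiRealFieldType) (T : finType) (y : T -> R) K :
    (K < #|T|)%N -> (forall c, 0 <= y c < K%:R) ->
  exists c c', c != c' /\ `|y c - y c'| < 1.
Proof.
move=> ltKT yP.
have boxP c : (Num.truncn (y c) < K)%N.
  by have /andP[y0 yK] := yP c; rewrite truncn_lt_nat.
pose box c := Ordinal (boxP c).
have /injectivePn[c [c' ne_cc' eq_box]] : ~~ injectiveb box.
  by apply/injectiveP => /leq_card; rewrite card_ord leqNgt ltKT.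
exists c, c'; split=> //.
have /andP[y0 _] := yP c; have /andP[y0' _] := yP c'.
have := truncn_itv y0; have := truncn_itv y0'.
have -> : Num.truncn (y c) = Num.truncn (y c') by move: eq_box => /(congr1 val).
rewrite -natr1 ltr_norml => /andP[? ?] /andP[? ?]; apply/andP; split; lra.
Qed.

(** The [M ^ n] coefficient vectors with entries below [M] have values at [t] in an interval of
    length [2 * (L * M)]. Cut into [M ^ n - 1] pieces, it holds two values in close proximity, and
    [q] is the difference of their polynomials. *)
Lemma box_principle (R : archiRealFieldType) (t : R) (n M : nat) :
    (0 < n)%N -> (1 < M)%N ->
  exists q : {poly int}, [/\ q != 0, (size q <= n)%N,
    forall k, `|q`_k| <= M%:Z &
    `|(map_poly intr q).[t]| * M%:R ^+ n.-1 <= 4 * \sum_(k < n) `|t| ^+ k].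
Proof.
move=> n_gt0 M_gt1; set L := \sum_(k < n) _.
have L_gt0 : 0 < L.
  rewrite /L (bigD1 (Ordinal n_gt0)) //= expr0 ltr_pwDl // sumr_ge0 // => k _.
  by rewrite exprn_ge0.
pose T := {ffun 'I_n -> 'I_M}.
pose v (c : T) : R := \sum_(k < n) (c k)%:R * t ^+ k.
have M0 : (0 : R) < M%:R by rewrite ltr0n; lia.
have v_lt c : `|v c| < L * M%:R.
  apply: (@le_lt_trans _ _ (L * M.-1%:R)); last first.
    by rewrite ltr_pM2l // ltr_nat; lia.
  rewrite mulrC /L mulr_sumr; apply: le_trans (ler_norm_sum _ _ _) _.
  apply: ler_sum => k _; rewrite normrM normr_nat normrX ler_wpM2r ?exprn_ge0 //.
  by rewrite ler_nat; have := ltn_ord (c k); lia.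
pose K := (M ^ n).-1.
have Mn_gt1 : (1 < M ^ n)%N by rewrite -(exp1n n) ltn_exp2r.
have K_gt0 : (0 : R) < K%:R by rewrite ltr0n /K; lia.
have LM_gt0 : 0 < L * M%:R by apply: mulr_gt0.
pose y c := (v c + L * M%:R) / (2 * (L * M%:R)) * K%:R.
have [|c|c [c' [ne_cc' ltyy]]] := @pigeonhole_interval R T y K.
- by rewrite card_ffun !card_ord /K; lia.
- have := v_lt c; rewrite ltr_norml => /andP[? ?].
  rewrite /y -[X in _ < X]mul1r ltr_pM2r // pmulr_lge0 // divr_ge0 /=; try lra.
  by rewrite ltr_pdivrMr; lra.
pose q : {poly int} := \poly_(k < n)
  ((c (insubd (Ordinal n_gt0) k))%:Z - (c' (insubd (Ordinal n_gt0) k))%:Z).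
have qE (k : 'I_n) : q`_k = (c k)%:Z - (c' k)%:Z.
  by rewrite coef_poly ltn_ord valKd.
exists q; split.
- apply: contra_neq ne_cc' => q0; apply/ffunP=> k; apply/val_inj.
  by have := qE k; rewrite q0 coef0 /=; lia.
- exact: size_poly.
- move=> k; rewrite coef_poly; case: ltnP => // _.
  by set i := insubd _ _; have := ltn_ord (c i); have := ltn_ord (c' i); lia.
have -> : (map_poly intr q).[t] = v c - v c'.
  rewrite (@horner_coef_wide _ n); last exact: leq_trans (size_poly _ _) (size_poly _ _).
  rewrite -sumrB; apply: eq_bigr => k _.
  by rewrite coef_map /= qE intrB mulrBl.
move: ltyy; have -> : y c - y c' = (v c - v c') * (K%:R / (2 * (L * M%:R))).
  by rewrite /y; ring.
rewrite normrM [X in _ * X]gtr0_norm ?divr_gt0 //; last by lra.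
rewrite [X in X < _]mulrA ltr_pdivrMr ?mul1r; last by lra.
set d := `|_| => ltd; have d_ge0 : 0 <= d by apply: normr_ge0.
(* Here [M ^ n <= 2 * K] because [M ^ n] is at least 2; this factor and the one in the interval
   length make up the constant 4. *)
have : d * M%:R ^+ n <= d * (2 * K%:R).
  by rewrite ler_wpM2l // -natrX -natrM ler_nat /K; lia.
rewrite -[n in _ ^+ n](prednK n_gt0) exprSr => le1.
rewrite -(ler_pM2r M0) -mulrA; lra.
Qed.

Lemma normc_real_complex (R : rcfType) (x : R) :
  `|x%:C%C| = `|x|%:C%C :> R[i]%C.
Proof. by rewrite normc_def /= expr0n addr0 sqrtr_sqr. Qed.

Lemma complex_archi (R : archiRcfType) (x : R[i]%C) : x \is Num.real ->
  exists m : nat, x < m%:R.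
Proof.
move=> /RRe_real <-; exists (Num.truncn (complex.Re x)).+1.
by rewrite -(rmorph_nat (real_complex R)) ltcR truncnS_gt.
Qed.

(** Picking each new element with [rho] below a lower bound [e] of the earlier values yields
    [#|T| + 1] good elements with distinct [rho], two of which share a residue. *)
Lemma pigeonhole_seq (C : numDomainType) (T : finType) (A : eqType)
    (good : A -> Prop) (rho : A -> C) (res : A -> T) :
    (forall e, 0 < e -> exists2 a, good a & 0 < rho a < e) ->
  exists a b, [/\ good a, good b, res a = res b & rho a != rho b].
Proof.
move=> small.
have [s [e [sz_s _ s_good _ uniq_s]]] : exists s e,
    [/\ size s = #|T|.+1, 0 < e, forall a, a \in s -> good a,
     forall a, a \in s -> e <= rho a & uniq (map rho s)].
  elim: #|T|.+1 => [|k [s [e [sz_s e0 s_good s_ge uniq_s]]]].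
    by exists [::], 1; split.
  have [a good_a /andP[a0 a_lt]] := small e e0.
  exists (a :: s), (rho a); split=> //=; first by rewrite sz_s.
  - by move=> b; rewrite inE => /orP[/eqP-> // | /s_good].
  - move=> b; rewrite inE => /orP[/eqP-> // | /s_ge].
    by apply: le_trans; apply: ltW.
  - rewrite uniq_s andbT; apply/mapP => -[b /s_ge e_le Dab].
    by move: (lt_le_trans a_lt e_le); rewrite Dab ltxx.
have [a0 _ _] := small 1 ltr01.
have : ~~ uniq (map res s).
  apply/negP => /card_uniqP; rewrite size_map sz_s => card_s.
  by have := max_card (mem (map res s)); rewrite card_s ltnn.
case/(uniqPn (res a0)) => i [j [ltij]]; rewrite size_map => ltjs.
have ltis := ltn_trans ltij ltjs.
rewrite !(nth_map a0) // => eq_res; exists (nth a0 s i), (nth a0 s j).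
split=> //; try by apply: s_good; apply: mem_nth.
rewrite -!(nth_map a0 (rho a0)) // nth_uniq ?size_map //; by rewrite ltn_eqF.
Qed.

Section Units.

Variables (R : archiRcfType) (E : fieldExtType rat) (u : E) (p : {poly int}).
Hypothesis pu : primitive_with u p.

Local Notation n := (\dim {:E}).
Implicit Types q : {poly int}.

Local Notation C := R[i]%C.
Local Notation ev q := (map_poly intr q).[u].
Local Notation norm q := (\det (mul_mx p n q)).

Variable g : 'I_n -> {rmorphism E -> C}.
Hypothesis inj_g : injective (fun i => g i u).

Lemma rmorph_ev (K : nzRingType) (f : {rmorphism E -> K}) q :
  f (ev q) = (map_poly intr q).[f u].
Proof. by rewrite -horner_map map_rmorph_intr. Qed.

Lemma ev_eq0 q : (size q <= n)%N -> (ev q == 0) = (q == 0).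
Proof.
move=> sz_q; apply/idP/eqP=> [|->]; last by rewrite rmorph0 horner0.
rewrite -map_in_alg_intr (primitive_dvd _ pu) => dv.
apply/eqP; apply: contraLR dv => nz_q; apply/negP => /dvdp_leq.
rewrite map_poly_eq0_id0 ?intr_eq0 ?lead_coef_eq0 // => /(_ nz_q).
rewrite !size_map_inj_poly //; try exact: intr_inj.
by rewrite (primitive_size pu) ltnNge sz_q.
Qed.

Lemma norm_prod q : (norm q)%:~R = \prod_i g i (ev q).
Proof.
have [mon_p _ _] := pu.
rewrite (det_mul_mx_prod mon_p (primitive_size pu) q inj_g) => [|i].
  by apply: eq_bigr => i _; rewrite rmorph_ev.
by rewrite -rmorph_ev (primitive_root pu) rmorph0.
Qed.

Lemma norm_eq0 q : (size q <= n)%N -> (norm q == 0) = (q == 0).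
Proof.
move=> sz_q; rewrite -(intr_eq0 C) norm_prod; apply/prodf_eq0/eqP=> [[i _]|->].
  by rewrite fmorph_eq0 ev_eq0 // => /eqP.
by exists (Ordinal (adim_gt0 {:E})); rewrite // rmorph0 horner0 rmorph0.
Qed.

(* The box principle makes |g i1 (ev q)| of order m^(1-n) while every conjugate
   is at most of order m; as the norm is a nonzero integer, |g i2 (ev q)| is
   then at least of order m. *)
Lemma bounded_norm_small_ratio i1 i2 : i1 != i2 -> g i1 u \is Num.real ->
  exists B : nat, forall e : C, 0 < e -> exists q,
    [/\ q != 0, (size q <= n)%N, `|norm q| <= B%:Z
      & `|g i1 (ev q)| < e * `|g i2 (ev q)| ].
Proof.
move=> ne_i12 real_u; set t : R := complex.Re (g i1 u).
have Dt : t%:C%C = g i1 u by apply: RRe_real.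
pose L i := \sum_(k < n) `|g i u| ^+ k.
have n_gt0 : (0 < n)%N := adim_gt0 {:E}.
have n_gt1 : (1 < n)%N.
  have := max_card (mem [:: i1; i2]); rewrite card_ord; apply: leq_trans.
  by rewrite (card_uniqP _) //= inE ne_i12.
have L_ge1 i : 1 <= L i.
  rewrite /L (bigD1 (Ordinal n_gt0)) //= expr0 lerDl sumr_ge0 // => k _.
  by rewrite exprn_ge0.
pose D := 4 * \sum_i L i.
have LD i : 4 * L i <= D.
  rewrite ler_pM2l ?ltr0n // (bigD1 i) //= lerDl sumr_ge0 // => j _.
  exact: le_trans ler01 (L_ge1 j).
have LD1 i : L i <= D.
  apply: le_trans (LD i); rewrite ler_peMl ?ler1n //; exact: le_trans (L_ge1 i).
have D_gt0 : 0 < D by apply: lt_le_trans (LD1 i1); apply: lt_le_trans (L_ge1 i1).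
(* The norm is at most [a * (D * m) ^ (n - 1)], and [a * m ^ (n - 1) <= D]; hence the bound [D ^ n],
   free of [m]. *)
have [B ltB] : exists B : nat, D ^+ n < B%:R.
  by apply: complex_archi; rewrite realX // gtr0_real.
exists B => e e_gt0.
have [M ltM] : exists M : nat, D ^+ n / e < M%:R.
  by apply: complex_archi; rewrite gtr0_real // divr_gt0 // exprn_gt0.
have [q [nz_q sz_q q_le q_small]] := @box_principle R t n M.+2 n_gt0 isT.
set m := M.+2 in q_le q_small.
have m_gt0 : (0 : C) < m%:R by rewrite ltr0n.
exists q.
have a_le : `|g i1 (ev q)| * m%:R ^+ n.-1 <= D.
  apply: le_trans (LD i1); rewrite rmorph_ev -Dt.
  rewrite -(map_rmorph_intr (real_complex R)) horner_map /= normc_real_complex.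
  have -> : 4 * L i1 = (4 * \sum_(k < n) `|t| ^+ k)%:C%C.
    rewrite rmorphM rmorph_nat rmorph_sum /= /L -Dt; congr (_ * _).
    by apply: eq_bigr => k _; rewrite normc_real_complex rmorphXn.
  by rewrite -(rmorph_nat (real_complex R)) -rmorphXn -rmorphM lecR.
have g_le i : `|g i (ev q)| <= D * m%:R.
  rewrite rmorph_ev (@horner_coef_wide _ n); last first.
    exact: leq_trans (size_poly _ _) sz_q.
  apply: le_trans (ler_norm_sum _ _ _) _; apply: le_trans (ler_wpM2r (ltW m_gt0) (LD1 i)).
  rewrite mulr_suml; apply: ler_sum => k _; rewrite coef_map normrM normrX mulrC.
  rewrite ler_wpM2l ?exprn_ge0 //= -intr_norm -[m%:R]/(m%:Z%:~R) ler_int.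
  exact: q_le.
set a := `|g i1 _| in a_le *; set b := `|g i2 _|.
have nz_ev : ev q != 0 by rewrite ev_eq0.
have a_gt0 : 0 < a by rewrite normr_gt0 fmorph_eq0.
have b_gt0 : 0 < b by rewrite normr_gt0 fmorph_eq0.
have normE : `|norm q|%:~R = a * \prod_(i | i != i1) `|g i (ev q)| :> C.
  by rewrite intr_norm norm_prod normr_prod (bigD1 i1).
split=> //.
  rewrite -(ler_int C) normE; apply: le_trans (ltW ltB).
  apply: (@le_trans _ _ (a * (D * m%:R) ^+ n.-1)).
    rewrite ler_pM2l // -[n.-1](_ : #|predC1 i1| = _); last by rewrite cardC1 card_ord.
    by rewrite -prodr_const; apply: ler_prod => i _; rewrite normr_ge0 g_le.
  rewrite exprMn mulrCA -[n in _ <= _ ^+ n](prednK n_gt0) exprSr.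
  by rewrite ler_pM2l // exprn_gt0.
have norm_ge1 : 1 <= a * b * (D * m%:R) ^+ n.-2.
  have : 1 <= (`|norm q|%:~R : C).
    by rewrite ler1z -gtz0_ge1 normr_gt0 norm_eq0.
  move/le_trans; apply; rewrite normE (bigD1 i2) 1?eq_sym //= mulrA.
  rewrite ler_pM2l ?mulr_gt0 // -[n.-2](_ : #|[pred i | (i != i1) && (i != i2)]| = _).
    by rewrite -prodr_const; apply: ler_prod => i _; rewrite normr_ge0 g_le.
  have -> : #|[pred i | (i != i1) && (i != i2)]| = #|predC (mem [:: i1; i2])|.
    by apply: eq_card => i; rewrite !inE negb_or.
  have := cardC (mem [:: i1; i2]).
  rewrite (card_uniqP _) /= ?inE ?ne_i12 // card_ord => card_n.
  by rewrite -subn2 -[X in (X - _)%N]card_n addKn.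
have n1 : n.-1 = n.-2.+1 by move: n_gt1; case: (n) => [|[]].
have Mb : m%:R <= D ^+ n.-1 * b.
  have -> : D ^+ n.-1 * b = D * (b * D ^+ n.-2).
    by rewrite [in LHS]n1 exprS -mulrA [D ^+ _ * b]mulrC.
  apply: (@le_trans _ _ ((a * m%:R ^+ n.-1) * (b * D ^+ n.-2))); last first.
    by rewrite ler_pM2r // mulr_gt0 // exprn_gt0.
  rewrite -{1}[m%:R]mulr1; have -> : a * m%:R ^+ n.-1 * (b * D ^+ n.-2) =
      m%:R * (a * b * (D * m%:R) ^+ n.-2).
    by rewrite [in LHS]n1 exprS [(D * _) ^+ _]exprMn !mulrA [a * _]mulrC -!mulrA;
      do 2 congr (_ * _); rewrite mulrCA; congr (_ * _); rewrite mulrC.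
  by rewrite ler_pM2l.
have aD : a <= D.
  by apply: le_trans a_le; rewrite ler_peMr ?(ltW a_gt0) // exprn_ege1 // ler1n.
(* After scaling by [D ^ (n - 1)], the chain is: left side at most [D ^ n], less than [e * m] by the
   choice of [M], at most the right side by [Mb]. *)
rewrite -(ltr_pM2l (exprn_gt0 n.-1 D_gt0)).
apply: (@le_lt_trans _ _ (D ^+ n)).
  by rewrite -[n in _ <= _ ^+ n](prednK n_gt0) exprSr ler_pM2l // exprn_gt0.
rewrite mulrCA; apply: (@lt_le_trans _ _ (e * m%:R)); last by rewrite ler_pM2l.
rewrite mulrC -ltr_pdivrMr //; apply: lt_le_trans ltM _.
by rewrite ler_nat /m -addn2 leq_addr.
Qed.

Lemma integral_ev q : integralOver (intr : int -> E) u ->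
  integralOver (intr : int -> E) (ev q).
Proof.
move=> int_u; apply: integral_horner int_u.
by apply/integral_poly => i; rewrite coef_map; apply: integral_id.
Qed.

(** Writing [a = b + B! c] turns the quotient into 1 plus the value of [c] times [B! / ev b], and
    the last factor is integral. *)
Lemma integral_div_congr (B : nat) (a b : {poly int}) :
    integralOver (intr : int -> E) u ->
    (size a <= n)%N -> (size b <= n)%N -> b != 0 -> `|norm b| <= B%:Z ->
    (forall k, a`_k = b`_k %[mod B`!%:Z])%Z ->
  integralOver (intr : int -> E) (ev a / ev b).
Proof.
move=> int_u sz_a sz_b nz_b norm_b ab; set Q := (B`!%:Z)%R.
pose c : {poly int} := \poly_(k < n) ((a`_k - b`_k) %/ Q)%Z.
have Dc : a = b + Q *: c.
  apply/polyP => k; rewrite coefD coefZ coef_poly; case: ltnP => [_ | le_nk].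
    rewrite mulrC divzK ?subrKC //.
    by rewrite -eqz_mod_dvd; apply/eqP/ab.
  by rewrite mulr0 addr0 !nth_default //; apply: leq_trans le_nk.
have nz_evb : ev b != 0 by rewrite ev_eq0.
have [mon_p _ _] := pu.
have [s Ds] := det_mul_mx_eval mon_p (primitive_size pu) b (adim_gt0 {:E})
  (primitive_root pu).
have /dvdzP[d Dd] : (norm b %| Q)%Z.
  rewrite /dvdz; apply: dvdn_fact; rewrite absz_gt0 norm_eq0 // nz_b /=.
  by rewrite -lez_nat abszE.
(* norm b / ev b lies in Z[u], and norm b divides B!. *)
have -> : ev a / ev b = 1 + ev c * (d%:~R * ev s).
  apply: (mulIf nz_evb); rewrite divfK // Dc -mul_polyC.
  rewrite rmorphD hornerD rmorphM hornerM /= map_polyC hornerC /= Dd.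
  rewrite intrM -Ds; ring.
apply: integral_add; first exact: integral1.
apply: integral_mul; first exact: integral_ev.
by apply: integral_mul; [apply: integral_id | apply: integral_ev].
Qed.

(** Residues of the coefficients modulo [B!] take finitely many values, while the ratios [rho] get
    arbitrarily small. Congruence is symmetric, so both the quotient and its inverse are
    integral. *)
Lemma exists_unit_ratio i1 i2 :
    integralOver (intr : int -> E) u -> i1 != i2 -> g i1 u \is Num.real ->
  exists v : E, [/\ v != 0, integralOver (intr : int -> E) v,
    integralOver (intr : int -> E) v^-1 & `|g i1 v| != `|g i2 v| ].
Proof.
move=> int_u ne_i12 real_u.
have [B small] := bounded_norm_small_ratio ne_i12 real_u.
pose good q := [/\ q != 0, (size q <= n)%N & `|norm q| <= B%:Z].
pose rho q := `|g i1 (ev q)| / `|g i2 (ev q)|.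
have lt_res (x : int) : (`|(x %% B`!%:Z)%Z| < B`!)%N.
  rewrite -ltz_nat abszE ger0_norm ?modz_ge0 ?ltz_pmod //; have := fact_gt0 B; lia.
pose res q := [ffun k : 'I_n => Ordinal (lt_res q`_k)].
have [e e_gt0|a [b [[nz_a sz_a norm_a] [nz_b sz_b norm_b] eq_res ne_rho]]] :=
    @pigeonhole_seq _ _ _ good rho res.
  have [q [nz_q sz_q norm_q lt_q]] := small e e_gt0; exists q => //.
  by rewrite divr_gt0 ?normr_gt0 ?fmorph_eq0 ?ev_eq0 //= ltr_pdivrMr
             ?normr_gt0 ?fmorph_eq0 ?ev_eq0.
have ab k : (a`_k = b`_k %[mod B`!%:Z])%Z.
  have [lt_kn | le_nk] := ltnP k n; last by rewrite !nth_default ?(leq_trans _ le_nk).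
  move/ffunP/(_ (Ordinal lt_kn)): eq_res; rewrite !ffunE => /(congr1 val) /= eq_ab.
  have /(congr1 Posz) := eq_ab.
  by rewrite !abszE !ger0_norm ?modz_ge0 //; have := fact_gt0 B; lia.
have nz_eva : ev a != 0 by rewrite ev_eq0.
have nz_evb : ev b != 0 by rewrite ev_eq0.
exists (ev a / ev b); split.
- by rewrite mulf_neq0 // invr_neq0.
- exact: integral_div_congr norm_b ab.
- by rewrite invf_div; apply: integral_div_congr norm_a _ => // k; apply/esym/ab.
apply: contra_neq ne_rho => eq_v; rewrite /rho.
move: eq_v; rewrite !rmorphM !fmorphV !normrM !normfV => eq_v.
have n0 i q : ev q != 0 -> `|g i (ev q)| != 0 by rewrite normr_eq0 fmorph_eq0.
apply/eqP; rewrite eqr_div ?n0 //; apply/eqP.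
by move/eqP: eq_v; rewrite eqr_div ?n0 // => /eqP->; rewrite mulrC.
Qed.

End Units.

(** * Minimal polynomials of generators *)

Lemma unit_polyE (A : idomainType) (a : {poly A}) :
  (a \is a GRing.unit) = (size a == 1)%N && (a`_0 \is a GRing.unit).
Proof. exact: poly_unitE. Qed.

(** One factor vanishes at [u] and so has full degree; the other is then a constant dividing the
    leading coefficient 1. *)
Lemma primitive_irreducible (E : fieldExtType rat) (u : E) (p : {poly int}) :
  primitive_with u p -> irreducible_in p.
Proof.
move=> pu; have sz_p := primitive_size pu; have [mon_p _ _] := pu.
have n_gt0 := adim_gt0 {:E}.
have factor (a b : {poly int}) : p = a * b -> (map_poly intr a).[u] = 0 ->
    b \is a GRing.unit.
  move=> Dp au.
  have nz_ab : a * b != 0 by rewrite -Dp monic_neq0.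
  have [nz_a nz_b] : a != 0 /\ b != 0.
    by apply/andP; rewrite -negb_or -mulf_eq0.
  have sz_a : (size p <= size a)%N.
    have : (map_poly intr p : {poly rat}) %| map_poly intr a.
      by rewrite -(primitive_dvd _ pu) map_in_alg_intr au.
    move/dvdp_leq; rewrite map_poly_eq0_id0 ?intr_eq0 ?lead_coef_eq0 //.
    by rewrite !size_map_inj_poly //; try exact: intr_inj; apply.
  have sz_b : size b = 1%N.
    apply/eqP; rewrite eqn_leq size_poly_gt0 nz_b andbT.
    have := nz_a; move: sz_a; rewrite Dp size_mul // -size_poly_gt0.
    by case: (size a) => // k; rewrite addSn /= -addn1 leq_add2l.
  rewrite unit_polyE sz_b eqxx /= unitrE; apply/eqP.
  have : lead_coef a * lead_coef b = 1 by rewrite -lead_coefM -Dp (monicP mon_p).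
  rewrite {2}/lead_coef sz_b /= => ab1.
  have ub : b`_0 \is a GRing.unit by apply/unitrPr; exists (lead_coef a); rewrite mulrC.
  by rewrite mulrV.
split=> [|a b Dp]; first by rewrite unit_polyE sz_p eqSS gtn_eqF.
have /eqP := primitive_root pu; rewrite {1}Dp rmorphM hornerM /= mulf_eq0.
case/orP => /eqP root0; [right; exact: factor Dp root0 | left].
by apply: factor root0; rewrite mulrC.
Qed.

Lemma reciprocal_polyE (A : nzRingType) (p : {poly A}) :
  reciprocal_poly p = \poly_(i < size p) p`_((size p).-1 - i).
Proof.
rewrite poly_def /reciprocal_poly (reindex_inj rev_ord_inj) /=.
have subE m k : (k < m)%N -> (m - k.+1 = m.-1 - k)%N /\ (m.-1 - (m.-1 - k) = k)%N.
  by lia.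
by apply: eq_bigr => i _; have [-> ->] := subE _ _ (ltn_ord i).
Qed.

(** The conjugate [sigma u] is the inverse of [u], so the reversed polynomial also vanishes at [u]
    and is a scalar multiple [c0] of [p]. *)
Lemma primitive_reciprocal (E : fieldExtType rat) (u : E) (p : {poly int})
    (sigma : {rmorphism E -> E}) :
    (1 < \dim {:E})%N -> primitive_with u p -> u * sigma u = 1 ->
  p = reciprocal_poly p.
Proof.
move=> n_gt1 pu usu; have sz_p := primitive_size pu; have [mon_p _ _] := pu.
rewrite reciprocal_polyE sz_p /=; move: n_gt1 sz_p; set n := \dim _ => n_gt1 sz_p.
set rp := \poly_(_ < _) _.
have nz_u : u != 0 by apply: contra_eq_neq usu => ->; rewrite mul0r eq_sym oner_neq0.
have Dsu : sigma u = u^-1 by apply: (mulfI nz_u); rewrite usu mulfV.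
have rpu : (map_poly intr rp).[u] = 0.
  have : (map_poly intr p).[sigma u] = 0.
    by rewrite -(map_rmorph_intr sigma) horner_map (primitive_root pu) rmorph0.
  rewrite (@horner_coef_wide _ n.+1); last by rewrite -sz_p size_poly.
  rewrite Dsu => p_inv; rewrite (@horner_coef_wide _ n.+1); last first.
    exact: leq_trans (size_poly _ _) (size_poly _ _).
  transitivity (u ^+ n * 0); last by rewrite mulr0.
  rewrite -[X in _ = _ * X]p_inv mulr_sumr [RHS](reindex_inj rev_ord_inj) /=.
  apply: eq_bigr => i _.
  have le_in : (i <= n)%N by rewrite -ltnS.
  rewrite !coef_map coef_poly ltn_ord /= subSS mulrCA; congr (_ * _).
  by rewrite -[in u ^+ n](subnK le_in) exprD exprVn mulrAC mulfV ?mul1r ?expf_neq0.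
have : (map_poly intr p : {poly rat}) %| map_poly intr rp.
  by rewrite -(primitive_dvd _ pu) map_in_alg_intr rpu.
have mon_pQ : (map_poly intr p : {poly rat}) \is monic by apply: monic_map.
have sz_pQ : size (map_poly intr p : {poly rat}) = n.+1.
  by rewrite size_map_inj_poly //; exact: intr_inj.
case/dvdpP=> c Dc.
have {Dc} [c0 Dc] : exists c0 : rat, map_poly intr rp = c0 *: map_poly intr p.
  exists c`_0; rewrite Dc -mul_polyC; congr (_ * _); apply: size1_polyC.
  have [->|nz_c] := eqVneq c 0; first by rewrite size_poly0.
  have : (size (map_poly intr rp : {poly rat}) <= n.+1)%N.
    exact: leq_trans (size_poly _ _) (size_poly _ _).
  by rewrite Dc size_Mmonic // sz_pQ addnS /= -add1n leq_add2r.
have coef_rp i : (i < n.+1)%N -> (p`_(n - i))%:~R = c0 * (p`_i)%:~R.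
  move=> lt_in; have := congr1 (fun q : {poly rat} => q`_i) Dc.
  by rewrite coefZ !coef_map /= coef_poly lt_in.
have p_n : p`_n = 1 by move: (monicP mon_p); rewrite /lead_coef sz_p.
(* Compare the coefficients of degrees 0 and [n]. *)
have c0_sq : c0 ^+ 2 = 1.
  have := coef_rp 0 isT; have := coef_rp n (ltnSn n).
  by rewrite subnn subn0 p_n mulr1 => ->; rewrite expr2 => <-.
move/eqP: c0_sq; rewrite sqrf_eq1 => /orP[] /eqP c0E; rewrite {}c0E in Dc.
  apply: (map_inj_poly (@intr_inj rat)) => //.
  by rewrite Dc scale1r.
(* The case [c0 = -1]: a polynomial and its reversal agree at 1, so [p] would have the factor
   ['X - 1], against irreducibility in degree above 1. *)
have root1 : p.[1] = 0.
  have := congr1 (fun q : {poly rat} => q.[1]) Dc.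
  rewrite hornerZ.
  have -> : (map_poly intr rp : {poly rat}).[1] = (map_poly intr p).[1].
    rewrite (@horner_coef_wide _ n.+1); last first.
      exact: leq_trans (size_poly _ _) (size_poly _ _).
    rewrite (@horner_coef_wide _ n.+1) ?sz_pQ // (reindex_inj rev_ord_inj) /=.
    apply: eq_bigr => i _; rewrite !expr1n !mulr1 !coef_map coef_poly /= subSS.
    by rewrite ltnS leq_subr subKn // -ltnS.
  rewrite -[1]/((1 : int)%:~R) horner_map /= => p1.
  apply: (@intr_inj rat); rewrite mulr0z; lra.
have /factor_theorem[b Db] : root p 1 by apply/rootP.
have [_ irr] := primitive_irreducible pu.
case: (irr _ _ Db); rewrite unit_polyE ?size_XsubC //= => /andP[/eqP sz_b _].
have := sz_p; rewrite Db size_Mmonic ?monicXsubC -?size_poly_gt0 ?sz_b //.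
by rewrite size_XsubC => -[] n1; move: n_gt1; rewrite -n1.
Qed.

(* If t is not in Q(u), its minimal polynomial over Q(u) has another root, and
   f has a second extension from Q(u) to E. *)
Lemma separating_generates (E : fieldExtType rat) (C : numClosedFieldType)
    (t u : E) (p : {poly int}) (f : {rmorphism E -> C}) :
    primitive_with t p ->
    (forall h : {rmorphism E -> C}, h u = f u -> h =1 f) ->
  <<1; u>>%VS = fullv.
Proof.
move=> pt sep; have [mon_p Dp Dt] := pt; set K := <<1%AS; u>>%AS.
suffices tK : t \in K.
  apply/eqP; rewrite eqEsubv subvf /= -Dt.
  by apply/FadjoinP; split; [apply: sub1v|].
rewrite -adjoin_deg_eq1; apply: contraT => deg_t.
set m := minPoly K t.
have [rs Drs] := closed_field_poly_normal (map_poly f m).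
have mon_m : map_poly f m \is monic by rewrite map_monic monic_minPoly.
rewrite (monicP mon_m) scale1r in Drs.
have uniq_rs : uniq rs.
  rewrite -separable_prod_XsubC -Drs separable_map; apply: pcharf0_separable => l.
  by rewrite (fmorph_pchar (in_alg E)) pchar_num.
have sz_rs : size rs = adjoin_degree K t.
  apply: succn_inj; rewrite -(size_prod_XsubC _ id) -Drs size_map_poly.
  exact: size_minPoly.
have [r r_rs ne_r] : exists2 r, r \in rs & r != f t.
  case: rs {Drs} uniq_rs sz_rs => [_ /esym/eqP | r [_ /esym deg1|r' rs]].
  - by rewrite -leqn0 leqNgt.
  - by rewrite deg1 in deg_t.
  rewrite /= inE negb_or => /andP[/andP[ne_rr' _] _] _.
  have [Dr | ne_r] := eqVneq r (f t); last by exists r; rewrite ?inE ?eqxx.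
  by exists r'; rewrite ?inE ?eqxx ?orbT // -Dr eq_sym.
have dv_root q : m %| q -> root (map_poly f q) r.
  by rewrite -(dvdp_map f) Drs => /dvdpP[s ->]; rewrite rootM root_prod_XsubC r_rs orbT.
have [|h Dh] := @primitive_embedding _ C t p r pt.
  rewrite -(map_rmorph_intr f); apply: dv_root; rewrite Dp.
  by apply: minPolyS; apply: sub1v.
(* If [u] is [q] evaluated at [t], then [m] divides [q - u] over [K], so [r] is a root of the image
   of [q - u] under [f]. *)
have hu : h u = f u.
  have [q Dq] := primitive_horner u Dt.
  have : root (map_poly f (map_poly (in_alg E) q - u%:P)) r.
    apply: dv_root; apply: minPoly_dvdp.
      rewrite rpredB ?polyOverC ?memv_adjoin //.
      by apply: (polyOverSv (sub1v K)); apply: alg_polyOver.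
    by rewrite /root !hornerE -Dq subrr.
  rewrite rmorphB /= map_polyC rootE !hornerE subr_eq0 => /eqP <-.
  rewrite {1}Dq -horner_map /= Dh -!map_poly_comp; congr (_.[_]).
  by apply: eq_map_poly => a /=; rewrite alg_num_field !fmorph_rat.
by rewrite -Dh (sep h hu t) eqxx in ne_r.
Qed.

(** * Salem fields *)

Section SalemField.

Variables (R : realType) (E : fieldExtType rat) (sigma : 'AEnd(E)).
Hypothesis sigmaK : involutive sigma.
Hypothesis real_fixed : totally_real R (subvs_of (fixedSpace sigma)).

Local Notation C := R[i]%C.

Implicit Types h : {rmorphism E -> C}.

Lemma fixed_real h x : sigma x = x -> h x \is Num.real.
Proof.
move=> /fixedSpaceP fix_x.
pose f : {rmorphism subvs_of (fixedSpace sigma) -> C} := h \o vsval.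
exact: (real_fixed f (Subvs fix_x)).
Qed.

(** Over the fixed field, E has basis 1, [x] with [sigma x = - x]. As [x ^+ 2] is fixed, [h x] has a
    real square, so conjugation fixes or negates it. *)
Lemma real_or_conj t h : sigma t != t ->
  real_embedding h \/ forall z, (h z)^* = h (sigma z).
Proof.
move=> ne_t; have [x sx nz_x] : exists2 x, sigma x = - x & x != 0.
  exists (t - sigma t); first by rewrite rmorphB /= sigmaK opprB.
  by rewrite subr_eq0 eq_sym.
have nz2 : (2 : E) != 0.
  by rewrite -(rmorph_nat (in_alg E)) fmorph_eq0 pnatr_eq0.
have split_E z : exists a b,
    [/\ (h a)^* = h a, (h b)^* = h b, z = a + b * x & sigma z = a - b * x].
  exists ((z + sigma z) / 2), ((z - sigma z) / (2 * x)); split.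
  - apply/CrealP/fixed_real.
    by rewrite fmorph_div rmorphD /= sigmaK rmorph_nat addrC.
  - apply/CrealP/fixed_real.
    rewrite fmorph_div rmorphB /= sigmaK rmorphM rmorph_nat /= sx.
    by rewrite mulrN invrN mulrN -mulNr opprB.
  - by field; rewrite nz_x nz2.
  - by field; rewrite nz_x nz2.
have : (h (x ^+ 2))^* == h (x ^+ 2).
  by apply/eqP/CrealP/fixed_real; rewrite rmorphXn /= sx sqrrN.
rewrite !rmorphXn /= eqf_sqr => /orP[] /eqP hx; [left|right] => z.
  have [a [b [ha hb -> _]]] := split_E z.
  by apply/CrealP; rewrite !(rmorphD, rmorphM) /= ha hb hx.
have [a [b [ha hb Dz Dsz]]] := split_E z; rewrite Dsz Dz.
by rewrite !(rmorphD, rmorphM) /= ha hb hx !(rmorphN, rmorphM) mulrN.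
Qed.

End SalemField.

Theorem proposition1p6 (R : realType) (E : fieldExtType rat)
    (hE : salem_field R E) :
  exists S : {poly int},
    salem_poly R S /\
    exists phi : {lrmorphism {poly %/ (map_poly intr S : {poly rat})} -> E},
      bijective phi.
Proof.
case: hE => n_ge4 [f1 [f2 [real1 real2 ne12 only12]]] [sigma [sigmaK real_fixed]].
have [t int_t Dt] := integral_primitive_element E.
have [p mon_p Dp] := integral_minPoly int_t.
have pt : primitive_with t p by split.
have [g [inj_g g_surj]] := @primitive_embeddings E R[i]%C t p pt.
have g_of (h : {rmorphism E -> R[i]%C}) : exists i, h =1 g i.
  have [|i Di] := g_surj (h t).
    by rewrite rootE -(map_rmorph_intr h) horner_map (primitive_root pt) rmorph0.
  by exists i; apply: primitive_ext Dt Di.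
have [i1 D1] := g_of f1; have [i2 D2] := g_of f2.
have ne_i12 : i1 != i2.
  by apply/eqP=> Di; apply: ne12 => z; rewrite D1 D2 Di.
(* Otherwise [sigma] is the identity and all embeddings, at least four, are real. *)
have ne_t : sigma t != t.
  apply/eqP=> st.
  have sid z : sigma z = z.
    exact: (@primitive_ext E E t (sigma : {rmorphism E -> E}) idfun Dt st z).
  have : {subset enum 'I_(\dim {:E}) <= [:: i1; i2]}.
    move=> i _; rewrite !inE.
    have real_gi : real_embedding (g i) by move=> z; apply: fixed_real (sid z).
    by case: (only12 _ real_gi) => gi; [rewrite (inj_g i i1)|rewrite (inj_g i i2)];
       rewrite ?eqxx ?orbT //= gi ?D1 ?D2.
  move/uniq_leq_size => /(_ (enum_uniq _)); rewrite size_enum_ord /= => n_le2.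
  by have := leq_trans n_ge4 n_le2.
have dich h := real_or_conj sigmaK real_fixed h ne_t.
(* The real embedding [f1 \o sigma] differs from [f1] at [t], so it can only be [f2]. *)
have f2E z : f2 z = f1 (sigma z).
  pose f1s : {rmorphism E -> R[i]%C} := f1 \o sigma.
  have real_f1s : real_embedding f1s by move=> y; apply: real1.
  case: (only12 _ real_f1s) => [/(_ t) /= /fmorph_inj st | <- //].
  by rewrite st eqxx in ne_t.
have real_g1 : g i1 t \is Num.real by rewrite -D1.
have [v [nz_v int_v int_Vv ne_v]] := exists_unit_ratio pt inj_g int_t ne_i12 real_g1.
rewrite -D1 -D2 in ne_v.
have nz_sv : sigma v != 0 by rewrite fmorph_eq0.
pose u := (sigma v / v) ^+ 2.
have int_u : integralOver (intr : int -> E) u.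
  rewrite /u expr2; have int_sv : integralOver (intr : int -> E) (sigma v).
    have [q mon_q qv] := int_v; exists q => //.
    by rewrite -(map_rmorph_intr (sigma : {rmorphism E -> E})) fmorph_root.
  by do 2?[apply: integral_mul].
have su : sigma u = u^-1.
  by rewrite rmorphXn /= fmorph_div /= sigmaK -exprVn invf_div.
have nz_u : u != 0 by rewrite expf_neq0 // mulf_neq0 // invr_neq0.
have usu : u * sigma u = 1 by rewrite su mulfV.
set c1 := f1 u; set c2 := f2 u.
have c12 : c1 * c2 = 1 by rewrite /c1 /c2 f2E -rmorphM usu rmorph1.
have c1_gt0 : 0 < c1.
  rewrite lt_neqAle eq_sym fmorph_eq0 nz_u /c1 rmorphXn /=.
  by rewrite real_exprn_even_ge0.
have c2_gt0 : 0 < c2 by rewrite -(pmulr_rgt0 _ c1_gt0) c12.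
(* By [f2E], [c1] is the square of [f2 v / f1 v], whose absolute value is not 1. *)
have c1_neq1 : c1 != 1.
  apply: contra_neq ne_v; rewrite -[c1]ger0_norm ?ltW // /c1 rmorphXn normrX.
  move/eqP; rewrite pexpr_eq1 ?normr_ge0 // fmorph_div -f2E normf_div.
  by move/eqP/divr1_eq.
have c2_neq1 : c2 != 1.
  by apply: contra_neq c1_neq1 => c2_1; rewrite -c12 c2_1 mulr1.
have ne_c12 : c1 != c2.
  apply: contra_neq c1_neq1 => c1c2; move: c12; rewrite -c1c2 -expr2 => /eqP.
  by rewrite pexpr_eq1 ?ltW // => /eqP.
have emb_u (h : {rmorphism E -> R[i]%C}) : [\/ h =1 f1, h =1 f2 | `|h u| = 1].
  have [/only12[]|conj_h] := dich h; [by constructor 1|by constructor 2|].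
  constructor 3; apply/eqP; rewrite -(@pexpr_eq1 _ _ 2) // normCK conj_h.
  by rewrite -rmorphM usu rmorph1.
(* An embedding equal to [f1] at [u] is neither [f2], as [c1 != c2], nor one sending [u] to the unit
   circle, as [c1] is positive and not 1. *)
have Du : <<1; u>>%VS = fullv.
  apply: (separating_generates pt (f := f1)) => h hu.
  case: (emb_u h) => // [h2|norm_h].
    by move: ne_c12; rewrite /c1 -hu h2 eqxx.
  by move: c1_neq1; rewrite -norm_h hu gtr0_norm ?eqxx.
have [S mon_S DS] := integral_minPoly int_u.
have uS : primitive_with u S by split.
exists S; split; last exact: primitive_iso uS.
have Dc1 : ((complex.Re c1)%:C)%C = c1 by apply: RRe_real; apply: gtr0_real.
have Dc2 : ((complex.Re c2)%:C)%C = c2 by apply: RRe_real; apply: gtr0_real.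
have root_f (h : {rmorphism E -> R[i]%C}) : root (map_poly intr S) (h u).
  by rewrite rootE -(map_rmorph_intr h) horner_map (primitive_root uS) rmorph0.
split=> //.
- exact: primitive_irreducible uS.
- by rewrite (primitive_size uS) ltnS.
- apply: (primitive_reciprocal (sigma := (sigma : {rmorphism E -> E})) _ uS usu).
  exact: leq_trans n_ge4.
exists (complex.Re c1), (complex.Re c2); rewrite Dc1 Dc2; split.
- by rewrite -ltcR Dc1.
- by rewrite -ltcR Dc2.
- by apply: contra_neq ne_c12 => Re12; rewrite -Dc1 -Dc2 Re12.
- by split; rewrite ?root_f // gtr0_norm.
(* Each complex root of [S] is the image of [u] under some embedding, so [emb_u] locates it. *)
move=> z root_z norm_z; have [h Dz] := primitive_embedding uS root_z.
case: (emb_u h) => [h1|h2|norm_h]; [left|right|].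
- by rewrite -Dz h1.
- by rewrite -Dz h2.
by rewrite -Dz norm_h eqxx in norm_z.
Qed.
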